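(* Let $X$ be a compact metric space and let $T\colon X\to X$ be a continuous map satisfying the Closing Lemma and having a point with dense orbit. Let $(f_n)_{n\in\mathbb{N}}$ be an almost additive sequence (with respect to $T$) of continuous functions $f_n\colon X\to\mathbb{R}$ with bounded variation. Then a continuous function $f\colon X\to\mathbb{R}$ such that $(S_nf)_{n\in\mathbb{N}}$ has bounded variation satisfies $$\lim_{n\to\infty}\frac1n\|f_n-S_nf\|_\infty=0\quad\text{if and only if}\quad \sup_{n\in\mathbb{N}}\|f_n-S_nf\|_\infty<\infty.$$ In particular, if $f\colon X\to\mathbb R$ is continuous and $(S_nf)_{n\in\mathbb{N}}$ does not have bounded variation, then $\sup_{n\in\mathbb{N}}\|f_n-S_nf\|_\infty=\infty$.
   Context: $\mathbb{N}=\{1,2,\dots\}$, $d$ is the metric of $X$, $\|\cdot\|_\infty$ is the supremum norm, $S_nf=\sum_{k=0}^{n-1}f\circ T^k$. Closing Lemma: $T$ satisfies the Closing Lemma if for every $\varepsilon>0$ there exists $\delta>0$ such that whenever $x\in X$ and $n\in\mathbb{N}$ satisfy $d(T^n(x),x)<\delta$, there exists $y\in X$ with $T^n(y)=y$ and $d(T^k(x),T^k(y))<\varepsilon$ for all $0\le k<n$. A point $x$ has dense orbit (is transitive) if $\overline{\{T^n(x):n\in\mathbb{N}\}}=X$. Almost additive: $(f_n)_{n\in\mathbb N}$ is almost additive if there is $C>0$ with $-C+f_m(x)+f_n(T^m(x))\le f_{m+n}(x)\le f_m(x)+f_n(T^m(x))+C$ for all $x\in X$, $m,n\ge1$. Bounded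 variation: there is $\varepsilon>0$ such that $\sup_{n}\sup\{|f_n(x)-f_n(y)|: d(T^k(x),T^k(y))<\varepsilon\text{ for }0\le k\le n-1\}<\infty$. *)

(* Defs.v *)
From HB Require Import structures.
From mathcomp Require Import all_boot all_order all_algebra.
From mathcomp Require Import all_classical all_reals all_analysis.

Set Implicit Arguments.
Unset Strict Implicit.
Unset Printing Implicit Defensive.

Import Order.TTheory GRing.Theory Num.Theory.
Import numFieldNormedType.Exports.

Local Open Scope classical_set_scope.
Local Open Scope ring_scope.

(* Sequences indexed by the positive integers are
   represented by functions on [nat] whose value at 0 is never constrained. *)

(* Extended-real valued, so that no boundedness is presupposed. It is -oo if
   [X] is empty; a continuous real function on a nonempty compact space has
   a finite nonnegative value. *)
Definition supnorm (R : realType) (X : Type) (g : X -> R) : \bar R :=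
  ereal_sup [set `|g x|%:E | x in [set: X]].

Definition birkhoff (R : realType) (X : Type) (T : X -> X) (f : X -> R)
    (n : nat) (x : X) : R :=
  \sum_(0 <= k < n) f (iter k T x).

Definition closing_lemma (R : realType) (X : metricType R) (T : X -> X) : Prop :=
  forall eps : R, 0 < eps -> exists2 delta : R, 0 < delta &
    forall (x : X) (n : nat), (0 < n)%N -> mdist (iter n T x) x < delta ->
      exists2 y : X, iter n T y = y &
        forall k : nat, (k < n)%N -> mdist (iter k T x) (iter k T y) < eps.

Definition transitive_point (X : topologicalType) (T : X -> X) (x : X) : Prop :=
  closure [set iter n T x | n in [set n : nat | (0 < n)%N]] = [set: X].

Definition almost_additive (R : realType) (X : Type) (T : X -> X)
    (f : nat -> X -> R) : Prop :=
  exists2 C : R, 0 < C &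
    forall (x : X) (m n : nat), (0 < m)%N -> (0 < n)%N ->
      - C + f m x + f n (iter m T x) <= f (m + n)%N x
        <= f m x + f n (iter m T x) + C.

Definition bowen_variation (R : realType) (X : metricType R)
    (T : X -> X) (g : X -> R) (n : nat) (eps : R) : \bar R :=
  ereal_sup [set `|g p.1 - g p.2|%:E |
    p in [set p : X * X | forall k : nat, (k < n)%N ->
            mdist (iter k T p.1) (iter k T p.2) < eps]].

Definition bounded_variation_seq (R : realType) (X : metricType R)
    (T : X -> X) (f : nat -> X -> R) : Prop :=
  exists2 eps : R, 0 < eps &
    (ereal_sup [set bowen_variation T (f n) n eps
      | n in [set n : nat | (0 < n)%N]] < +oo)%E.

(* Main.v *)
Require Import Defs.
From HB Require Import structures.
From mathcomp Require Import all_boot all_order all_algebra.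
From mathcomp Require Import all_classical all_reals all_analysis.
From mathcomp Require Import lra.

(** On periodic orbits a sublinear almost additive sequence is bounded by its
    additivity constant, since going [k] times around the orbit multiplies its
    value by [k] up to an error [k * C].  The Closing Lemma and bounded variation
    carry this bound to all orbit segments which almost close up.  By compactness
    the first [N] points of a dense orbit come close to every point, so each
    initial segment of that orbit is, up to at most [N] steps, almost closed; a
    general segment of it is a difference of two initial ones.  Density and
    continuity conclude. *)

Import Order.TTheory GRing.Theory Num.Theory.
Import numFieldNormedType.Exports.

Local Open Scope classical_set_scope.
Local Open Scope ring_scope.

(** * Real bounds in place of extended-real suprema *)

Lemma ereal_sup_ltyP {R : realType} (A : set (\bar R)) :
  (ereal_sup A < +oo)%E <-> exists K : R, forall y, A y -> (y <= K%:E)%E.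
Proof.
split=> [|[K AK]]; last first.
  by apply: (@le_lt_trans _ _ K%:E); [exact: ge_ereal_sup | exact: ltry].
case E : (ereal_sup A) => [r| |] // _.
- by exists r => y Ay; rewrite -E; exact: ereal_sup_ubound.
- exists 0 => y Ay; apply: (@le_trans _ _ (ereal_sup A)).
    exact: ereal_sup_ubound.
  by rewrite E leNye.
Qed.

Lemma supnorm_leP {R : realType} {X : Type} {g : X -> R} {K : R} :
  (supnorm g <= K%:E)%E <-> forall x, `|g x| <= K.
Proof.
split=> [gK x|gK]; last first.
  by apply: ge_ereal_sup => _ [x _ <-]; rewrite lee_fin.
rewrite -lee_fin; apply: le_trans gK.
by apply: ereal_sup_ubound; exists x.
Qed.

Lemma supnorm_ge0 {R : realType} {X : Type} (g : X -> R) (x : X) :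
  (0 <= supnorm g)%E.
Proof.
apply: (@le_trans _ _ `|g x|%:E); first by rewrite lee_fin.
by apply: ereal_sup_ubound; exists x.
Qed.

Lemma sup_supnorm_ltyP {R : realType} {X : Type} {g : nat -> X -> R} :
  (ereal_sup [set supnorm (g n) | n in [set n : nat | (0 < n)%N]] < +oo)%E <->
  exists K, forall n x, (0 < n)%N -> `|g n x| <= K.
Proof.
split=> [/ereal_sup_ltyP[K gK]|[K gK]].
  exists K => n x n0; apply: supnorm_leP.1.
  by apply: gK; exists n.
apply/ereal_sup_ltyP; exists K => _ [n n0 <-].
by apply/supnorm_leP => x; exact: gK.
Qed.

Lemma bounded_variation_seqP {R : realType} {X : metricType R} {T : X -> X}
    {g : nat -> X -> R} :
  bounded_variation_seq T g <->
  exists2 eps : R, 0 < eps & exists V, forall n x y, (0 < n)%N ->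
    (forall k, (k < n)%N -> mdist (iter k T x) (iter k T y) < eps) ->
    `|g n x - g n y| <= V.
Proof.
split=> [[eps eps0 /ereal_sup_ltyP[V gV]]|[eps eps0 [V gV]]].
  exists eps => //; exists V => n x y n0 xy; rewrite -lee_fin.
  apply: (@le_trans _ _ (bowen_variation T (g n) n eps)); last first.
    by apply: gV; exists n.
  by apply: ereal_sup_ubound; exists (x, y).
exists eps => //; apply/ereal_sup_ltyP; exists V => _ [n n0 <-].
by apply: ge_ereal_sup => _ [[x y] /= xy <-]; rewrite lee_fin; exact: gV.
Qed.

Lemma bounded_variation_seqB {R : realType} {X : metricType R} {T : X -> X}
    {f g : nat -> X -> R} :
  bounded_variation_seq T f -> bounded_variation_seq T g ->
  bounded_variation_seq T (fun n => f n \- g n).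
Proof.
move=> /bounded_variation_seqP[e e0 [V fV]] /bounded_variation_seqP[d d0 [W gW]].
apply/bounded_variation_seqP; exists (Num.min e d); first by rewrite lt_min e0.
exists (V + W) => n x y n0 xy /=.
rewrite opprD addrACA -opprD; apply: (le_trans (ler_normB _ _)).
by apply: lerD; [apply: fV|apply: gW] => // k kn;
  move: (xy k kn); rewrite lt_min => /andP[].
Qed.

Lemma bounded_variation_seq_bounded {R : realType} {X : metricType R}
    {T : X -> X} {g : nat -> X -> R} {K : R} :
  (forall n x, (0 < n)%N -> `|g n x| <= K) -> bounded_variation_seq T g.
Proof.
move=> gK; apply/bounded_variation_seqP; exists 1 => //; exists (K + K).
move=> n x y n0 _; apply: (le_trans (ler_normB _ _)).
by apply: lerD; exact: gK.
Qed.

(** * Cocycle identity and continuity of Birkhoff sums *)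

Lemma birkhoffD {R : realType} {X : Type} {T : X -> X} (f : X -> R)
    (m n : nat) (x : X) :
  birkhoff T f (m + n) x = birkhoff T f m x + birkhoff T f n (iter m T x).
Proof.
rewrite /birkhoff (big_cat_nat (n := m)) ?leq_addr//=; congr (_ + _).
rewrite -{1}[m]add0n big_addn addKn.
by apply: eq_bigr => k _; rewrite iterD.
Qed.

Lemma iter_continuous {X : topologicalType} {T : X -> X} (n : nat) :
  continuous T -> continuous (iter n T).
Proof.
move=> cT; elim: n => [|n IHn] x; first exact: cvg_id.
by apply: continuous_comp; [exact: IHn | exact: cT].
Qed.

Lemma birkhoff_continuous {R : realType} {X : topologicalType} {T : X -> X}
    (f : X -> R) (n : nat) :
  continuous T -> continuous f -> continuous (birkhoff T f n).
Proof.
move=> cT cf; elim: n => [|n IHn] x.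
  rewrite (_ : birkhoff T f 0 = cst 0); first exact: cvg_cst.
  by apply/funext => z; rewrite /birkhoff big_geq.
rewrite (_ : birkhoff T f n.+1 = fun z => birkhoff T f n z + f (iter n T z)).
  apply: cvgD; first exact: IHn.
  by apply: continuous_comp; [exact: iter_continuous | exact: cf].
by apply/funext => z; rewrite /birkhoff big_nat_recr.
Qed.

(** * Values on periodic orbits *)

Section almost_additive.
Context {R : realType} {X : Type} {T : X -> X} {g : nat -> X -> R} {C : R}.
Hypothesis aag : forall x m n, (0 < m)%N -> (0 < n)%N ->
  `|g (m + n)%N x - (g m x + g n (iter m T x))| <= C.

(** Every turn starts again at [y], so [k.+1] turns are glued at [k] joints, each costing at most
    [C]. Counting from [k.+1] keeps clear of the unconstrained [g 0]. *)
Lemma almost_additive_periodic {n : nat} (k : nat) {y : X} :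
  (0 < n)%N -> iter n T y = y ->
  `|g (k.+1 * n)%N y - k.+1%:R * g n y| <= k%:R * C.
Proof.
move=> n0 Ty; elim: k => [|k IHk]; first by rewrite mul1n !mul1r subrr normr0 mul0r.
have := aag y n (k.+1 * n)%N n0; rewrite muln_gt0 n0 => /(_ isT); rewrite Ty.
move: IHk; rewrite [in X in _ -> _ -> X]mulSn -(natr1 k.+1) -(natr1 k) !ler_norml.
by move=> /andP[a b] /andP[c d]; apply/andP; split; lra.
Qed.

Lemma sublinear_periodic_le {n : nat} {y : X} :
  (forall e, 0 < e -> \forall m \near \oo, forall x, `|g m x| <= e * m%:R) ->
  (0 < n)%N -> iter n T y = y -> `|g n y| <= C.
Proof.
move=> sub n0 Ty; apply/ler_addgt0Pr => e e0.
have n0R : 0 < n%:R :> R by rewrite ltr0n.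
(* At rate [e / n], the value over [N.+1] turns, of total length [N.+1 * n >= N], is at most
   [N.+1 * e]. The [N] joints add at most [N * C], and dividing by [N.+1] leaves at most [C + e]. *)
have [N _ gN] := sub _ (divr_gt0 e0 n0R).
have kN : (N <= N.+1 * n)%N.
  by apply: (leq_trans (leqnSn _)); rewrite leq_pmulr.
have := gN _ kN y; rewrite natrM mulrCA divfK ?gt_eqF// => gy.
have C0 : 0 <= C := le_trans (normr_ge0 _) (aag y 1 1 isT isT).
have := almost_additive_periodic N n0 Ty => per.
have N0 : 0 < N.+1%:R :> R by rewrite ltr0n.
rewrite -(ler_pM2l N0) -{1}(gtr0_norm N0) -normrM.
have := ler_normB (g (N.+1 * n)%N y) (g (N.+1 * n)%N y - N.+1%:R * g n y).
rewrite subKr => /le_trans; apply.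
by move: gy per; rewrite -natr1; lra.
Qed.

End almost_additive.

(** * Uniform density of a finite piece of the dense orbit *)

Lemma transitive_point_near {R : realType} {X : metricType R} {T : X -> X}
    {x0 : X} {delta : R} :
  compact [set: X] -> transitive_point T x0 -> 0 < delta ->
  exists N, forall y, exists2 j, (0 < j <= N)%N &
    mdist (iter j T x0) y < delta.
Proof.
move=> /compact_near_coveringP cX x0T d0.
(* [P N y] persists as [N] grows, so the near-covering form of compactness reduces a common [N] to a
   local statement around each point. *)
pose P N y := exists2 j, (0 < j <= N)%N & mdist (iter j T x0) y < delta.
suff [N _ NP] : \forall N \near \oo, [set: X] `<=` P N.
  by exists N => y; exact: (NP N (leqnn N) y I).
apply: cX => y _.
have : closure [set iter n T x0 | n in [set n : nat | (0 < n)%N]] y.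
  by rewrite x0T.
have d20 : 0 < delta / 2 by lra.
move=> /(_ _ (nbhsx_ballx y _ d20)) [_ [[j j0 <-]]].
rewrite ballEmdist /= => yj.
(* The half radius lets the single time [j] found for [y] serve the whole ball around [y]. *)
exists (ball y (delta / 2), [set n | (j <= n)%N]).
  by split; [exact: nbhsx_ballx | exists j].
move=> [z n] /=; rewrite ballEmdist /= => -[yz jn].
exists j; first by rewrite j0.
apply: (le_lt_trans (metric_triangle _ y _)).
by rewrite metric_sym; lra.
Qed.

(** * From periodic orbits to all orbits *)

Section sublinear_bounded.
Context {R : realType} {X : metricType R} {T : X -> X}.
Context {g : nat -> X -> R} {C : R}.
Hypothesis aag : forall x m n, (0 < m)%N -> (0 < n)%N ->
  `|g (m + n)%N x - (g m x + g n (iter m T x))| <= C.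
Hypothesis sub :
  forall e, 0 < e -> \forall m \near \oo, forall x, `|g m x| <= e * m%:R.

(** Closing is requested at the scale [eps] of bounded variation: replacing [x] by the shadowing
    periodic point costs at most [V], and the periodic value is at most [C]. *)
Lemma almost_closed_bounded :
  closing_lemma T -> bounded_variation_seq T g ->
  exists2 delta : R, 0 < delta & exists K, forall n x, (0 < n)%N ->
    mdist (iter n T x) x < delta -> `|g n x| <= K.
Proof.
move=> clT /bounded_variation_seqP[eps eps0 [V gV]].
have [delta d0 dT] := clT _ eps0.
exists delta => //; exists (V + C) => n x n0 /(dT _ _ n0)[y Ty xy].
rewrite -(subrK (g n y) (g n x)); apply: (le_trans (ler_normD _ _)).
by apply: lerD; [exact: gV | exact: (sublinear_periodic_le aag)].
Qed.

(** Some [j <= N] has [iter j T x0] close to [iter n T x0]. If [j < n], the segment from time [j] to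
    time [n] almost closes up, and only the first [j] steps remain to be bounded. *)
Lemma dense_orbit_bounded {x0 : X} :
  compact [set: X] -> closing_lemma T -> bounded_variation_seq T g ->
  transitive_point T x0 ->
  exists K, forall n, (0 < n)%N -> `|g n x0| <= K.
Proof.
move=> cX clT bvg x0T.
have [delta d0 [K gK]] := almost_closed_bounded clT bvg.
have [N xN] := transitive_point_near cX x0T d0.
pose M := \sum_(0 <= j < N.+1) `|g j x0|.
have gM j : (j <= N)%N -> `|g j x0| <= M.
  move=> jN; rewrite /M (bigD1_seq j) ?iota_uniq ?mem_index_iota//=.
  by rewrite lerDl sumr_ge0.
have C0 : 0 <= C := le_trans (normr_ge0 _) (aag x0 1 1 isT isT).
(* The sign of [K] is unknown; its absolute value keeps the total above [M], as the short case
   [n <= j] requires. *)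
have K0 : 0 <= `|K| by [].
exists (M + `|K| + C) => n n0.
have [j /andP[j0 jN] xj] := xN (iter n T x0).
case: (leqP n j) => [nj|jn].
  by have := gM _ (leq_trans nj jN); lra.
have nj0 : (0 < n - j)%N by rewrite subn_gt0.
have gret : `|g (n - j)%N (iter j T x0)| <= `|K|.
  apply: le_trans (ler_norm K); apply: gK => //.
  by rewrite -iterD subnK 1?ltnW// metric_sym.
have := aag x0 j _ j0 nj0; rewrite subnKC 1?ltnW// => aaj.
move: (gM _ jN) gret aaj; rewrite !ler_norml.
by move=> /andP[a b] /andP[c d] /andP[p q]; apply/andP; split; lra.
Qed.

(** At [iter k T x0] the value of [g n] is [g (k + n) x0 - g k x0] up to [C], hence at most
    [K + K + C] in absolute value. For fixed [n] this bound defines a closed set, which contains the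
    dense orbit. *)
Theorem sublinear_bounded :
  compact [set: X] -> closing_lemma T -> (exists x, transitive_point T x) ->
  (forall n, (0 < n)%N -> continuous (g n)) -> bounded_variation_seq T g ->
  exists K, forall n x, (0 < n)%N -> `|g n x| <= K.
Proof.
move=> cX clT [x0 x0T] cg bvg.
have [K gK] := dense_orbit_bounded cX clT bvg x0T.
exists (K + K + C) => n x n0.
have Fclosed : closed [set z | `|g n z| <= K + K + C].
  apply: (preimage_closed _ (@closed_le _ (K + K + C))) => z _.
  by apply: cvg_norm; exact: cg.
suff : closure [set iter k T x0 | k in [set k : nat | (0 < k)%N]]
    `<=` [set z | `|g n z| <= K + K + C].
  by rewrite x0T; apply.
rewrite ((closure_id _).1 Fclosed); apply: closureS => _ [k k0 <-] /=.
have kn0 : (0 < k + n)%N by rewrite addn_gt0 k0.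
move: (gK _ kn0) (gK _ k0) (aag x0 k n k0 n0); rewrite !ler_norml.
by move=> /andP[a b] /andP[c d] /andP[p q]; apply/andP; split; lra.
Qed.

End sublinear_bounded.

(** * The normalized limit as uniform sublinearity *)

Lemma cvg_supnorm_sublinear {R : realType} {X : Type} {g : nat -> X -> R}
    (x0 : X) :
  ((fun n : nat => (n%:R^-1 : R)%:E * supnorm (g n))%E @ \oo --> 0%E) <->
  (forall e, 0 < e -> \forall m \near \oo, forall x, `|g m x| <= e * m%:R).
Proof.
split=> [/fine_cvgP[fing cvg0] e e0|sub].
  have small := (cvgr0Pnorm_le _).1 cvg0 _ e0.
  near=> m => x.
  have m0 : 0 < m%:R :> R by rewrite ltr0n; near: m; exact: nbhs_infty_gt.
  have : ((m%:R^-1)%:E * supnorm (g m) <= e%:E)%E.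
    rewrite -[leLHS]fineK; last by near: m; exact: fing.
    by rewrite lee_fin; apply: le_trans (ler_norm _) _; near: m; exact: small.
  rewrite lee_pdivrMl// => /supnorm_leP/(_ x).
  by rewrite mulrC.
apply/fine_cvgP.
(* The point [x0] gives the lower bound 0: on an empty space [supnorm] is -oo and the limit fails,
   although sublinearity holds vacuously. *)
have le m e : (0 < m)%N -> (forall x, `|g m x| <= e * m%:R) ->
    (0 <= (m%:R^-1 : R)%:E * supnorm (g m) <= e%:E)%E.
  move=> m0 gm; rewrite mule_ge0 ?(supnorm_ge0 _ x0)//=.
  by rewrite lee_pdivrMl ?ltr0n//; apply/supnorm_leP => x; rewrite mulrC.
split.
  near=> m.
  have /andP[a b] : (0 <= (m%:R^-1 : R)%:E * supnorm (g m) <= 1%:E)%E.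
    apply: le; first by near: m; exact: nbhs_infty_gt.
    by near: m; exact: sub.
  by rewrite ge0_fin_numE//; apply: (le_lt_trans b); rewrite ltry.
apply/cvgr0Pnorm_le => e e0; near=> m.
have /andP[a b] : (0 <= (m%:R^-1 : R)%:E * supnorm (g m) <= e%:E)%E.
  apply: le; first by near: m; exact: nbhs_infty_gt.
  by near: m; exact: sub.
have fin : ((m%:R^-1 : R)%:E * supnorm (g m))%E \is a fin_num.
  by rewrite ge0_fin_numE//; apply: (le_lt_trans b); rewrite ltry.
by rewrite /= ger0_norm ?fine_ge0// -lee_fin fineK.
Unshelve. all: by end_near. Qed.

Lemma bounded_sublinear {R : realType} {X : Type} {g : nat -> X -> R} {K : R} :
  (forall n x, (0 < n)%N -> `|g n x| <= K) ->
  forall e, 0 < e -> \forall m \near \oo, forall x, `|g m x| <= e * m%:R.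
Proof.
move=> gK e e0; near=> m => x.
apply: (@le_trans _ _ K).
  by apply: gK; near: m; exact: nbhs_infty_gt.
rewrite mulrC -ler_pdivrMr//; apply: ltW; near: m; exact: nbhs_infty_gtr.
Unshelve. all: by end_near. Qed.

Theorem corollary6 (R : realType) (X : metricType R) (T : X -> X)
    (cptX : compact [set: X]) (contT : continuous T)
    (closT : closing_lemma T) (transT : exists x : X, transitive_point T x)
    (f_ : nat -> X -> R)
    (contf_ : forall n : nat, (0 < n)%N -> continuous (f_ n))
    (aaf_ : almost_additive T f_) (bvf_ : bounded_variation_seq T f_) :
  (forall f : X -> R, continuous f -> bounded_variation_seq T (birkhoff T f) ->
     ((fun n : nat => (n%:R^-1 : R)%R%:E * supnorm (f_ n \- birkhoff T f n)%R)%E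
        @ \oo --> 0%E)
     <->
     (ereal_sup [set supnorm (f_ n \- birkhoff T f n)%R
                  | n in [set n : nat | (0 < n)%N]] < +oo)%E)
  /\
  (forall f : X -> R, continuous f -> ~ bounded_variation_seq T (birkhoff T f) ->
     ereal_sup [set supnorm (f_ n \- birkhoff T f n)%R
                 | n in [set n : nat | (0 < n)%N]] = +oo%E).
Proof.
have [x0 x0T] := transT.
split=> f cf; last first.
  (* If the supremum were finite, the Birkhoff sums would be [f_] minus a bounded sequence, and both
     have bounded variation. *)
  apply: contra_notP => /eqP; rewrite -ltey => /sup_supnorm_ltyP[K fK].
  have -> : birkhoff T f = fun n => f_ n \- (f_ n \- birkhoff T f n).
    by apply/funext => n; apply/funext => x /=; rewrite subKr.
  apply: bounded_variation_seqB => //.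
  exact: bounded_variation_seq_bounded fK.
move=> bvf; split; last first.
  move=> /sup_supnorm_ltyP[K gK]; apply/(cvg_supnorm_sublinear x0).
  exact: bounded_sublinear gK.
move=> /(cvg_supnorm_sublinear x0) sub; apply/sup_supnorm_ltyP.
have [C C0 aaf] := aaf_.
(* Birkhoff sums are exactly additive, so subtracting them from [f_] preserves the constant [C]. *)
apply: (@sublinear_bounded _ _ T _ C) => //.
- move=> x m n m0 n0 /=; have /andP[] := aaf x m n m0 n0.
  by rewrite birkhoffD ler_norml => a b; apply/andP; split; lra.
- move=> n n0 x; apply: cvgB; first exact: contf_.
  exact: birkhoff_continuous.
- exact: bounded_variation_seqB.
Qed.
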